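(* Let $X$ be a metric space. Fix an integer $n\ge 2$ such that there exists a Lipschitz retraction $r\colon X(n)\to X(n-1)$. Suppose $I\subset\mathbb{R}$ is a nondegenerate compact interval and there exist Lipschitz maps $f\colon X\to I$ and $g\colon I\to X$ such that $f\circ g=\mathrm{id}_I$. Then $$\operatorname{Lip}(r)\ge \frac{n-3}{\operatorname{Lip}(f)\,\operatorname{Lip}(g)} .$$
   Context: For a metric space $(X,d)$ and a positive integer $n$, $X(n)$ denotes the $n$th finite subset space of $X$: the set of all nonempty subsets of $X$ of cardinality at most $n$, with the Hausdorff distance $d_H(A,B)=\max\{\max_{a\in A}\min_{b\in B}d(a,b),\ \max_{b\in B}\min_{a\in A}d(a,b)\}$. For $k\le n$ we regard $X(k)\subset X(n)$. A map $f\colon M\to N$ between metric spaces is Lipschitz if there is $L\ge 0$ with $d(f(x),f(x'))\le L\,d(x,x')$ for all $x,x'\in M$; the least such $L$ is denoted $\operatorname{Lip}(f)$. If $N\subset M$, a Lipschitz retraction $r\colon M\to N$ is a Lipschitz map whose restriction to $N$ is the identity. The interval $I$ carries the usual metric of $\mathbb{R}$; nondegenerate means containing more than one point. *)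

(* Defs.v *)
From HB Require Import structures.
From mathcomp Require Import all_boot all_order all_algebra finmap.
From mathcomp Require Import all_classical all_reals topology normedtype.

Set Implicit Arguments.
Unset Strict Implicit.
Unset Printing Implicit Defensive.

Import Order.TTheory GRing.Theory Num.Theory.
Import numFieldTopology.Exports.

Local Open Scope classical_set_scope.
Local Open Scope ring_scope.

Section subset_metric.
Context {R : realType} {X : metricType R} (A : set X).

Let dist (x y : A) : R := mdist (set_val x) (set_val y).

Let dist_ge0 x y : 0 <= dist x y. Proof. exact: mdist_ge0. Qed.

Let dist_positivity x y : dist x y = 0 -> x = y.
Proof. by move=> /mdist_positivity; exact: val_inj. Qed.

Let dist_ballE (x : A) d : ball x d = [set y | dist x y < d].
Proof.
by apply/seteqP; split=> y; rewrite /ball/= /initial_ball/= ballEmdist.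
Qed.

HB.instance Definition _ := @PseudoMetric_isMetric.Build R (A : Type)
  dist dist_ge0 dist_positivity dist_ballE.

End subset_metric.

(* The library's lipschitz predicates are restricted to normed modules. *)
Section lipschitz.
Context {R : realType} {M N : metricType R}.
Implicit Types (f : M -> N) (L : R).

Definition lipschitz_with L f :=
  forall x x' : M, mdist (f x) (f x') <= L * mdist x x'.

Definition lipschitz_map f := exists2 L, 0 <= L & lipschitz_with L f.

Definition Lip f : R := inf [set L | 0 <= L /\ lipschitz_with L f].

Lemma Lip_ge0 f : 0 <= Lip f.
Proof.
rewrite /Lip.
have [->|/set0P ne] := eqVneq [set L | 0 <= L /\ lipschitz_with L f] set0.
  by rewrite inf_out// => -[[]].
by apply: lb_le_inf => // L [].
Qed.

Lemma Lip_le L f : 0 <= L -> lipschitz_with L f -> Lip f <= L.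
Proof. by move=> L0 fL; apply: ge_inf => //; exists 0 => ? []. Qed.

(* The infimum is attained, i.e. Lip f is the least Lipschitz constant of f. *)
Lemma Lip_lipschitz f : lipschitz_map f -> lipschitz_with (Lip f) f.
Proof.
move=> [L0 L00 fL0] x x'.
have [xx'|] := ltP 0 (mdist x x'); last first.
  rewrite le_eqVlt ltNge mdist_ge0 orbF => /eqP xx'.
  by have := fL0 x x'; rewrite xx' !mulr0.
rewrite -ler_pdivrMr//; apply: lb_le_inf; first by exists L0.
by move=> L [_ /(_ x x')]; rewrite ler_pdivrMr.
Qed.

End lipschitz.

Section extrema.
Context {R : realType} {T : choiceType}.
Implicit Types (A : {fset T}) (F : T -> R).

Definition fset_min A F : R := inf [set F a | a in [set` A]].
Definition fset_max A F : R := sup [set F a | a in [set` A]].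

Lemma fset_argmin A F : A != fset0 ->
  exists2 a, a \in A & forall b, b \in A -> F a <= F b.
Proof.
case/fset0Pn => a0 Aa0.
case: (@Order.TotalTheory.arg_minP _ _ A [` Aa0]%fset xpredT (F \o val)) => //.
move=> a _ Fa; exists (val a); first exact: fsvalP.
by move=> b Ab; exact: (Fa [` Ab]%fset).
Qed.

(* The infimum and supremum above are a minimum and a maximum. *)
Lemma fset_minP A F : A != fset0 ->
  (exists2 a, a \in A & fset_min A F = F a) /\
  (forall b, b \in A -> fset_min A F <= F b).
Proof.
move=> /(@fset_argmin _ F)[a Aa Fa].
have lbF : lbound [set F b | b in [set` A]] (F a) by move=> _ [b Ab <-]; exact: Fa.
suff E : fset_min A F = F a by split; [exists a | rewrite E].
apply/eqP; rewrite eq_le; apply/andP; split.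
  by apply: ge_inf; [exists (F a) | exists a].
by apply: lb_le_inf => //; exists (F a); exists a.
Qed.

Lemma fset_maxP A F : A != fset0 ->
  (exists2 a, a \in A & fset_max A F = F a) /\
  (forall b, b \in A -> F b <= fset_max A F).
Proof.
move=> /(@fset_argmin _ (fun x => - F x))[a Aa Fa].
have ubF : ubound [set F b | b in [set` A]] (F a).
  by move=> _ [b Ab <-]; rewrite -lerN2; exact: Fa.
suff E : fset_max A F = F a.
  by split; [exists a | move=> b Ab; rewrite E -lerN2; exact: Fa].
apply/eqP; rewrite eq_le; apply/andP; split.
  by apply: ge_sup => //; exists (F a); exists a.
by apply: ub_le_sup; [exists (F a) | exists a].
Qed.

End extrema.

Section hausdorff.
Context {R : realType} {X : metricType R}.
Implicit Types A B C : {fset X}.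

Definition hausdorff_dist A B : R := Num.max
  (fset_max A (fun a => fset_min B (fun b => mdist a b)))
  (fset_max B (fun b => fset_min A (fun a => mdist a b))).

Let hdist_leP A B (e : R) : A != fset0 -> B != fset0 ->
  (forall a, a \in A -> exists2 b, b \in B & mdist a b <= e) ->
  (forall b, b \in B -> exists2 a, a \in A & mdist a b <= e) ->
  hausdorff_dist A B <= e.
Proof.
move=> A0 B0 AB BA; rewrite /hausdorff_dist ge_max; apply/andP; split.
- have [[a /AB[b Bb ab] ->] _] := fset_maxP (fun a => fset_min B (mdist a)) A0.
  by apply: le_trans ab; have [_] := fset_minP (mdist a) B0; apply.
- have [[b /BA[a Aa ab] ->] _] :=
    fset_maxP (fun b => fset_min A (fun a => mdist a b)) B0.
  by apply: le_trans ab; have [_] := fset_minP (fun a => mdist a b) A0; apply.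
Qed.

Lemma hausdorff_distl A B a : A != fset0 -> B != fset0 -> a \in A ->
  exists2 b, b \in B & mdist a b <= hausdorff_dist A B.
Proof.
move=> A0 B0 Aa; have [[b Bb E] _] := fset_minP (mdist a) B0.
exists b => //; rewrite -E /hausdorff_dist le_max; apply/orP; left.
by have [_] := fset_maxP (fun a => fset_min B (mdist a)) A0; apply.
Qed.

Lemma hausdorff_distC A B : hausdorff_dist A B = hausdorff_dist B A.
Proof.
have E A' : (fun b => fset_min A' (fun a => mdist a b)) =
            (fun b => fset_min A' (fun a => mdist b a)).
  by apply/funext => b; congr fset_min; apply/funext => a; exact: metric_sym.
by rewrite /hausdorff_dist maxC !E.
Qed.

Lemma hausdorff_distr A B b : A != fset0 -> B != fset0 -> b \in B ->
  exists2 a, a \in A & mdist a b <= hausdorff_dist A B.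
Proof.
move=> A0 B0 /(hausdorff_distl B0 A0)[a Aa ab]; exists a => //.
by rewrite metric_sym hausdorff_distC.
Qed.

Lemma hausdorff_dist_leP A B (e : R) : A != fset0 -> B != fset0 ->
  hausdorff_dist A B <= e <->
  (forall a, a \in A -> exists2 b, b \in B & mdist a b <= e) /\
  (forall b, b \in B -> exists2 a, a \in A & mdist a b <= e).
Proof.
move=> A0 B0; split=> [ABe|[AB BA]]; last exact: hdist_leP.
split=> x xin.
  by have [y yin xy] := hausdorff_distl A0 B0 xin; exists y => //; exact: le_trans ABe.
by have [y yin xy] := hausdorff_distr A0 B0 xin; exists y => //; exact: le_trans ABe.
Qed.

End hausdorff.

Record finsub {R : realType} (X : metricType R) (n : nat) := FinSub {
  fset_of_finsub :> {fset X};
  finsub_card : (0 < #|` fset_of_finsub | <= n)%N }.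

HB.instance Definition _ {R : realType} (X : metricType R) n :=
  [isSub for @fset_of_finsub R X n].
HB.instance Definition _ {R : realType} (X : metricType R) n :=
  [Choice of finsub X n by <:].

Section finsub_metric.
Context {R : realType} {X : metricType R} {n : nat}.
Implicit Types A B C : finsub X n.

Lemma finsub_neq0 A : fset_of_finsub A != fset0.
Proof. by rewrite -cardfs_gt0; have /andP[] := finsub_card A. Qed.

Let dist A B : R := hausdorff_dist A B.

Let dist_xx A : dist A A = 0.
Proof.
apply/eqP; rewrite eq_le; apply/andP; split.
  by apply/hausdorff_dist_leP; rewrite ?finsub_neq0//;
    split=> x xA; exists x; rewrite // mdistxx.
have /fset0Pn[a Aa] := finsub_neq0 A.
have [b _] := hausdorff_distl (finsub_neq0 A) (finsub_neq0 A) Aa.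
by apply: le_trans; exact: mdist_ge0.
Qed.

Let dist_positivity A B : dist A B = 0 -> A = B.
Proof.
move=> AB; apply/val_inj/fsetP => x; apply/idP/idP => xin.
  have [y yB] := hausdorff_distl (finsub_neq0 A) (finsub_neq0 B) xin.
  rewrite -/(dist A B) AB => xy0; suff -> : x = y by [].
  by apply: mdist_positivity; apply/eqP; rewrite eq_le xy0 mdist_ge0.
have [y yA] := hausdorff_distr (finsub_neq0 A) (finsub_neq0 B) xin.
rewrite -/(dist A B) AB => xy0; suff <- : y = x by [].
by apply: mdist_positivity; apply/eqP; rewrite eq_le xy0 mdist_ge0.
Qed.

Let dist_sym A B : dist A B = dist B A.
Proof. exact: hausdorff_distC. Qed.

Let dist_triangle B A C : dist A C <= dist A B + dist B C.
Proof.
have [A0 B0 C0] := And3 (finsub_neq0 A) (finsub_neq0 B) (finsub_neq0 C).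
apply/hausdorff_dist_leP => //; split=> x xin.
  have [y yin xy] := hausdorff_distl A0 B0 xin.
  have [z zin yz] := hausdorff_distl B0 C0 yin.
  by exists z => //; rewrite (le_trans (metric_triangle x y z))// lerD.
have [y yin xy] := hausdorff_distr B0 C0 xin.
have [z zin yz] := hausdorff_distr A0 B0 yin.
by exists z => //; rewrite (le_trans (metric_triangle z y x))// lerD.
Qed.

HB.instance Definition _ := @isMetric.Build R (finsub X n)
  dist dist_xx dist_positivity dist_sym dist_triangle.

Lemma mdist_finsubE A B : mdist A B = hausdorff_dist A B.
Proof. by []. Qed.

End finsub_metric.

Section retraction.
Context {R : realType} {X : metricType R} {k n : nat} (kn : (k <= n)%N).

Lemma finsub_incl_subproof (A : finsub X k) :
  (0 < #|` fset_of_finsub A | <= n)%N.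
Proof. by have /andP[-> /leq_trans->] := finsub_card A. Qed.

Definition finsub_incl (A : finsub X k) : finsub X n :=
  FinSub (finsub_incl_subproof A).

Definition lipschitz_retraction (r : finsub X n -> finsub X k) :=
  lipschitz_map r /\ cancel finsub_incl r.

End retraction.

(* Main.v *)
(* Composing with [f] and [g] gives a Lipschitz retraction of the finite subsets
   of an interval with at most [n] points onto those with at most [n - 1]
   points, with constant [L = Lip f * Lip g * Lip r]. Merging two closest points
   of a set [A] moves it by half its smallest gap [m], so the retraction moves
   [A] by at most [(L + 1) m / 2].

   Let [n] be even and parametrize the [n]-point sets with ends 0 and 1 by their
   [n - 1] gaps, a point of the simplex of dimension [n - 2]. If [L < n - 2],
   the displacement is less than 1/2, so the retracted set never shrinks to a
   single point. This is impossible: inserting a zero gap adds no point, so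
   the [n - 1] facets all carry the same map, and an odd number of copies of it
   cannot cancel in the homology modulo 2 of the sets with at least two points.
   Sperner labellings make this combinatorial: label a set by its longest gap,
   or by a separate label when it has a short gap or too few points.
   If [n] is odd, apply this to [n - 1] points and one distant extra point. *)

Require Import Defs.
From mathcomp Require Import all_boot all_order all_algebra finmap.
From mathcomp Require Import all_classical all_reals topology normedtype sequences.
From mathcomp Require Import ring lra zify.

Set Implicit Arguments.
Unset Strict Implicit.
Unset Printing Implicit Defensive.

Import Order.TTheory GRing.Theory Num.Theory.
Import numFieldTopology.Exports.

Local Open Scope classical_set_scope.
Local Open Scope ring_scope.

(** * Faces and coboundary modulo 2 *)

Section faces.
Context {T : eqType}.
Implicit Types (s : seq T) (phi : seq T -> 'F_2).

Fixpoint faces s : seq (seq T) :=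
  if s is x :: s' then s' :: [seq x :: t | t <- faces s'] else [::].

Definition coboundary phi s : 'F_2 := \sum_(t <- faces s) phi t.

Lemma addFF2 (x : 'F_2) : x + x = 0.
Proof. exact: addrr_pchar2 (pchar_Fp (isT : prime 2)) x. Qed.

Lemma coboundary_cons phi x s :
  coboundary phi (x :: s) = phi s + coboundary (fun t => phi (x :: t)) s.
Proof. by rewrite /coboundary /= big_cons big_map. Qed.

Lemma coboundaryD phi psi s :
  coboundary (fun t => phi t + psi t) s = coboundary phi s + coboundary psi s.
Proof. exact: big_split. Qed.

Lemma eq_coboundary phi psi s : phi =1 psi ->
  coboundary phi s = coboundary psi s.
Proof. by move=> E; apply: eq_bigr => t _; exact: E. Qed.

(** By [coboundary_cons], the double coboundary at [x :: s] splits into [coboundary phi s] taken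
    twice, which vanishes modulo 2, and a double coboundary at [s]. *)
Lemma coboundaryK phi s : coboundary (coboundary phi) s = 0.
Proof.
elim: s phi => [|x s IH] phi; first by rewrite /coboundary big_nil.
rewrite coboundary_cons (eq_coboundary _ (coboundary_cons phi x)).
by rewrite coboundaryD IH addr0 addFF2.
Qed.

Lemma face_perm s t : t \in faces s -> exists x, perm_eq s (x :: t).
Proof.
elim: s t => //= x s IH t; rewrite inE => /predU1P[->|/mapP[u /IH[y us] ->]].
  by exists x.
exists y; apply: (@perm_trans _ (x :: y :: u)); first by rewrite perm_cons.
by have /permPl := perm_catCA [:: x] [:: y] u; apply.
Qed.

Lemma size_face s t : t \in faces s -> size s = (size t).+1.
Proof. by case/face_perm => x /perm_size. Qed.

Lemma face_sub s t x : t \in faces s -> x \in t -> x \in s.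
Proof. by case/face_perm => y /perm_mem -> xt; rewrite inE xt orbT. Qed.

Lemma size_faces s : size (faces s) = size s.
Proof. by elim: s => //= x s; rewrite size_map => ->. Qed.

Lemma face_missing s t : uniq s -> t \in faces s -> exists2 x, x \in s & x \notin t.
Proof.
move=> us /face_perm[x st]; exists x; first by rewrite (perm_mem st) mem_head.
by move: us; rewrite (perm_uniq st) /= => /andP[].
Qed.

(** A face omits a position, while [rem] omits the first occurrence of a value; for repeated entries
    the results differ only by a permutation. *)
Lemma sum_faces_rem phi s :
  (forall t u, perm_eq t u -> phi t = phi u) ->
  coboundary phi s = \sum_(x <- s) phi (rem x s).
Proof.
elim: s phi => [|y s IH] phi E; first by rewrite /coboundary !big_nil.
rewrite coboundary_cons big_cons IH; last first.
  by move=> t u tu; apply: E; rewrite perm_cons.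
rewrite /= eqxx; congr (_ + _); apply: eq_big_seq => x xs; apply: E => /=.
case: eqP => [yx|//]; rewrite yx perm_sym; exact: perm_to_rem.
Qed.

End faces.

Lemma faces_map (T U : eqType) (h : T -> U) s :
  faces (map h s) = map (map h) (faces s).
Proof.
by elim: s => //= x s ->; congr (_ :: _); rewrite -!map_comp; exact: eq_map.
Qed.

Lemma natF2 n : n%:R = (odd n)%:R :> 'F_2.
Proof.
rewrite -{1}(odd_double_half n) -addnn !natrD addFF2 addr0//.
Qed.

(* The number of facets carrying exactly the labels of [s] is odd if and only
   if the simplex carries all the labels [a :: s]: otherwise one label repeats
   and such facets come in pairs. *)
Lemma coboundary_perm_eq (T : eqType) (a : T) (s w : seq T) : uniq (a :: s) ->
  size w = (size s).+1 -> {subset w <= a :: s} ->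
  coboundary (fun v => (perm_eq v s)%:R) w = (perm_eq w (a :: s))%:R.
Proof.
move=> uas sw ws; rewrite sum_faces_rem; last first.
  by move=> t u /permPl->.
have E x : x \in w -> perm_eq (rem x w) s = perm_eq w (x :: s).
  by move=> xw; rewrite (permPl (perm_to_rem xw)) perm_cons.
under eq_big_seq => x xw do rewrite E//.
(* If [w] is a permutation of [b :: s], the sum counts the occurrences of [b] in [w]: one if
   [b = a], two if [b] lies in [s]. *)
have [/hasP[b bw wb]|/hasPn H] := boolP (has (fun x => perm_eq w (x :: s)) w).
  under eq_bigr => x _ do rewrite (permPl wb).
  have F x : perm_eq (b :: s) (x :: s) = (x == b).
    apply/idP/eqP => [bx|->//].
    have := perm_cat2r s [:: b] [:: x]; rewrite /= bx => /esym/perm_mem/(_ b).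
    by rewrite !inE eqxx => /esym/eqP.
  under eq_bigr => x _ do rewrite F.
  have -> : \sum_(x <- w) (x == b)%:R = (count_mem b w)%:R :> 'F_2.
    rewrite -sum1_count natr_sum [RHS]big_mkcond.
    by apply: eq_bigr => x _ /=; case: (x == b).
  rewrite (permP wb) /= eqxx (permPl wb) F natF2.
  move: uas => /= /andP[anins us]; rewrite count_uniq_mem//.
  have := ws b bw; rewrite inE; have [->|ab /= ->//] := eqVneq b a.
  by rewrite (negbTE anins).
rewrite big1_seq; last by move=> x /andP[_ /H/negbTE->].
case: (boolP (perm_eq w (a :: s))) => // wa.
by have := H a; rewrite (perm_mem wa) mem_head wa => /(_ isT).
Qed.

(** * Barycentric subdivision *)

Section subdivision.
Context {R : realType}.
Local Notation V := (nat -> R).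
Implicit Types (s t : seq V) (phi : seq V -> 'F_2).

Definition barycenter s : V := fun i => (\sum_(x <- s) x i) / (size s)%:R.

(* [n] is the number of vertices of [s]. *)
Fixpoint sd n s : seq (seq V) :=
  if n is n'.+1 then
    flatten [seq [seq barycenter s :: t | t <- sd n' f] | f <- faces s]
  else [:: [::]].

Fixpoint sd_iter k s : seq (seq V) :=
  if k is k'.+1 then flatten [seq sd_iter k' t | t <- sd (size s) s] else [:: s].

Lemma size_sd n s t : size s = n -> t \in sd n s -> size t = n.
Proof.
elim: n s t => [|n IH] s t sn; first by rewrite inE => /eqP ->.
move=> /flattenP[_ /mapP[f fs ->] /mapP[u uf ->]] /=.
by rewrite (IH f)//; have := size_face fs; rewrite sn => -[].
Qed.

Lemma size_sd_iter k s t : t \in sd_iter k s -> size t = size s.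
Proof.
elim: k s t => [|k IH] s t; first by rewrite inE => /eqP ->.
by move=> /flattenP[_ /mapP[u us ->] /IH ->]; exact: size_sd us.
Qed.

Lemma sum_sdS n phi s : \sum_(t <- sd n.+1 s) phi t =
  \sum_(f <- faces s) \sum_(t <- sd n f) phi (barycenter s :: t).
Proof. by rewrite big_flatten big_map; apply: eq_bigr => f _; rewrite big_map. Qed.

(* Subdivision is a chain map: the facets containing the barycenter cancel in
   pairs. *)
Lemma sum_sd_coboundary n phi s : size s = n.+1 ->
  \sum_(t <- sd n.+1 s) coboundary phi t =
  coboundary (fun f => \sum_(t <- sd n f) phi t) s.
Proof.
elim: n phi s => [|n IH] phi s sn; rewrite sum_sdS.
  apply: eq_bigr => f _.
  by rewrite !big_seq1 coboundary_cons [X in _ + X]big_nil addr0.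
under eq_bigr => f _.
  under eq_bigr => t _ do rewrite coboundary_cons.
  rewrite big_split /=.
over.
rewrite big_split /= -[RHS]addr0; congr (_ + _).
under eq_big_seq => f fs.
  rewrite IH; last by have := size_face fs; rewrite sn => -[].
over.
exact: coboundaryK.
Qed.

Lemma sum_sd_iter_coboundary k phi s : s != [::] ->
  \sum_(t <- sd_iter k s) coboundary phi t =
  coboundary (fun f => \sum_(t <- sd_iter k f) phi t) s.
Proof.
elim: k s => [|k IH] s s0 /=.
  by rewrite big_seq1; apply: eq_bigr => f _; rewrite big_seq1.
rewrite big_flatten big_map.
have [n sn] : exists n, size s = n.+1 by case: s s0 => //= x s _; exists (size s).
under eq_big_seq => t ts.
  rewrite IH; last by rewrite -size_eq0 (size_sd _ ts)// sn.
over.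
rewrite sn sum_sd_coboundary//; apply: eq_big_seq => f fs.
have -> : size f = n by have := size_face fs; rewrite sn => -[].
by rewrite big_flatten big_map.
Qed.

(** Naturality of subdivision under affine maps; it is applied to the coface maps [insert0 j]. *)
Lemma sd_iter_map (h : V -> V) k s :
  (forall t, h (barycenter t) = barycenter (map h t)) ->
  sd_iter k (map h s) = map (map h) (sd_iter k s).
Proof.
move=> hb; have sd_map n u : sd n (map h u) = map (map h) (sd n u).
  elim: n u => [|n IH] u //=.
  rewrite map_flatten faces_map -!map_comp; congr flatten; apply: eq_map => f /=.
  by rewrite IH -!map_comp; apply: eq_map => t /=; rewrite hb.
elim: k s => //= k IH s; rewrite size_map sd_map map_flatten -!map_comp.
by congr flatten; apply: eq_map => t /=; exact: IH.
Qed.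

(** A weak convexity, just strong enough to pass from the vertices of a simplex to all vertices of
    its subdivisions. *)
Definition barycentric (P : V -> Prop) := forall s, s != [::] ->
  (forall x, x \in s -> P x) -> P (barycenter s).

Lemma sd_barycentric P n s t x : barycentric P -> size s = n ->
  (forall y, y \in s -> P y) -> t \in sd n s -> x \in t -> P x.
Proof.
move=> bP; elim: n s t => [|n IH] s t sn sP; first by rewrite inE => /eqP ->.
move=> /flattenP[_ /mapP[f fs ->] /mapP[u uf ->]].
rewrite inE => /predU1P[->|]; first by apply: bP => //; rewrite -size_eq0 sn.
apply: IH uf; first by have := size_face fs; rewrite sn => -[].
by move=> y /(face_sub fs)/sP.
Qed.

Lemma sd_iter_barycentric P k s t x : barycentric P ->
  (forall y, y \in s -> P y) -> t \in sd_iter k s -> x \in t -> P x.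
Proof.
move=> bP; elim: k s => [|k IH] s sP; first by rewrite inE => /eqP -> /sP.
move=> /flattenP[_ /mapP[u us ->] /IH]; apply.
by move=> y; exact: sd_barycentric us.
Qed.

(** * Mesh of iterated subdivisions *)

Definition spread D s :=
  forall x y i, x \in s -> y \in s -> `|x i - y i| <= D.

Lemma barycenterB s (a : R) i : s != [::] ->
  barycenter s i - a = (\sum_(x <- s) (x i - a)) / (size s)%:R.
Proof.
move=> s0; rewrite sumrB big_const_seq count_predT iter_addr_0 mulrBl.
by rewrite -[a *+ _]mulr_natr mulfK// pnatr_eq0 size_eq0.
Qed.

Lemma dist_barycenter D s (a : R) i : s != [::] ->
  (forall x, x \in s -> `|x i - a| <= D) -> `|barycenter s i - a| <= D.
Proof.
move=> s0 sD; have n0 : 0 < (size s)%:R :> R by rewrite ltr0n lt0n size_eq0.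
rewrite barycenterB// normrM normfV (gtr0_norm n0) ler_pdivrMr//.
apply: le_trans (ler_norm_sum _ _ _) _.
rewrite mulr_natr -(count_predT s) -iter_addr_0 -big_const_seq.
by rewrite big_seq [leRHS]big_seq; apply: ler_sum => x /sD.
Qed.

(** In the average of the differences to [x], the term of [x] itself is zero; this gains the factor
    below 1. *)
Lemma dist_barycenter_vertex D s x i : spread D s -> x \in s ->
  `|barycenter s i - x i| <= (size s).-1%:R / (size s)%:R * D.
Proof.
move=> sD xs; have s0 : s != [::] by apply: contraTneq xs => ->.
have n0 : 0 < (size s)%:R :> R by rewrite ltr0n lt0n size_eq0.
rewrite barycenterB// normrM normfV (gtr0_norm n0).
rewrite (perm_big _ (perm_to_rem xs)) /= big_cons subrr add0r mulrAC.
rewrite ler_pM2r ?invr_gt0// -(size_rem xs).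
apply: le_trans (ler_norm_sum _ _ _) _.
rewrite mulrC mulr_natr -(count_predT (rem x s)) -iter_addr_0 -big_const_seq.
rewrite big_seq [leRHS]big_seq; apply: ler_sum => y yx.
by apply: sD => //; exact: mem_rem yx.
Qed.

(** The bound [N] on the dimension is kept apart from [n], so that the induction over faces keeps
    one contraction factor. *)
Lemma sd_spread N D n s t : 0 <= D -> size s = n -> (n <= N.+1)%N ->
  spread D s -> t \in sd n s -> spread (N%:R / N.+1%:R * D) t.
Proof.
move=> D0; elim: n s t => [|n IH] s t sn nN sD; first by rewrite inE => /eqP->.
move=> /flattenP[_ /mapP[f fs ->] /mapP[u uf ->]].
have fn : size f = n by have := size_face fs; rewrite sn => -[].
have uD : spread (N%:R / N.+1%:R * D) u.
  apply: IH uf => //; first exact: ltnW.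
  by move=> x y i /(face_sub fs) xs /(face_sub fs); exact: sD.
(* Vertices of [u] are iterated barycenters of vertices of [f], and being close to the barycenter of
   [s] is preserved by barycenters. *)
have bD x i : x \in u -> `|barycenter s i - x i| <= N%:R / N.+1%:R * D.
  rewrite distrC; apply: (@sd_barycentric
    (fun y => `|y i - barycenter s i| <= N%:R / N.+1%:R * D)) uf => //.
    by move=> v v0 vD; exact: dist_barycenter.
  move=> y /(face_sub fs) ys; rewrite distrC.
  apply: le_trans (dist_barycenter_vertex _ sD ys) _; rewrite sn /=.
  apply: ler_wpM2r => //; rewrite ler_pdivrMr// mulrAC ler_pdivlMr//.
  by rewrite -!natrM ler_nat; nia.
move=> x y i; rewrite !inE => /predU1P[->|xu] /predU1P[->|yu].
- by rewrite subrr normr0 !mulr_ge0// invr_ge0.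
- exact: bD.
- by rewrite distrC; exact: bD.
- exact: uD.
Qed.

Lemma sd_iter_spread N D k s t : 0 <= D -> (size s <= N.+1)%N ->
  spread D s -> t \in sd_iter k s -> spread ((N%:R / N.+1%:R) ^+ k * D) t.
Proof.
elim: k D s => [|k IH] D s D0 sN sD.
  by rewrite inE => /eqP ->; rewrite mul1r.
move=> /flattenP[_ /mapP[u us ->] tu]; rewrite exprSr -mulrA.
apply: IH tu; first by rewrite !mulr_ge0// invr_ge0.
  by rewrite (size_sd _ us).
exact: sd_spread us.
Qed.

Lemma sd_iter_small N D (e : R) : 0 <= D -> 0 < e ->
  exists k, forall s t, (size s <= N.+1)%N -> spread D s ->
    t \in sd_iter k s -> spread e t.
Proof.
move=> D0 e0; set c : R := N%:R / N.+1%:R.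
have [k ck] : exists k, c ^+ k * D <= e.
  have c1 : `|c| < 1.
    by rewrite ger0_norm ?divr_ge0// ltr_pdivrMr// mul1r ltr_nat.
  have /(@cvgrPdist_le R R^o) cv := cvg_geometric D c1.
  have [k _ /(_ k (leqnn k)) /= ck] := cv e e0.
  by exists k; apply: le_trans ck; rewrite sub0r normrN mulrC; exact: ler_norm.
exists k => s t sN sD ts x y i xt yt; apply: le_trans ck.
exact: (sd_iter_spread D0 sN sD ts).
Qed.

End subdivision.

(** * Sperner's lemma *)

Section sperner.
Context {R : realType}.
Local Notation V := (nat -> R).
Implicit Types (x : V) (s : seq nat).

Definition vertex (i : nat) : V := fun l => (l == i)%:R.

(** Points are infinite sequences vanishing from [N] on, so simplices of all dimensions share one
    type. *)
Definition simplex N x :=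
  [/\ forall i, 0 <= x i, forall i, (N <= i)%N -> x i = 0 & \sum_(i < N) x i = 1].

Lemma simplex_vertex N i : (i < N)%N -> simplex N (vertex i).
Proof.
move=> iN; split=> [j|j Nj|]; rewrite /vertex ?ler0n//.
  by case: eqP Nj => [->|//]; rewrite leqNgt iN.
rewrite (bigD1 (Ordinal iN))//= eqxx big1 ?addr0// => j.
by rewrite -val_eqE /= => /negbTE ->.
Qed.

Lemma barycentric_simplex N : barycentric (simplex N).
Proof.
move=> s s0 sS; split=> [i|i Ni|].
- by rewrite divr_ge0// big_seq sumr_ge0// => x /sS[].
- by rewrite /barycenter big_seq big1 ?mul0r// => x /sS[_ ->].
- rewrite -mulr_suml exchange_big /= big_seq.
  under eq_bigr => x /sS[_ _ ->] do over.
  by rewrite -big_seq big_const_seq count_predT iter_addr_0 mulfV// pnatr_eq0 size_eq0.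
Qed.

Lemma barycentric_eq0 i : barycentric (fun x : V => x i = 0).
Proof.
by move=> s s0 sS; rewrite /barycenter big_seq big1 ?mul0r// => x /sS.
Qed.

Lemma sd_iter_simplex N k s t x : {subset s <= iota 0 N} ->
  t \in sd_iter k (map vertex s) -> x \in t -> simplex N x.
Proof.
move=> sN; apply: (@sd_iter_barycentric _ (simplex N)); first exact: barycentric_simplex.
move=> y /mapP[i /sN]; rewrite mem_iota /= => iN ->.
exact: simplex_vertex.
Qed.

Lemma sd_iter_support k s t x i : i \notin s ->
  t \in sd_iter k (map vertex s) -> x \in t -> x i = 0.
Proof.
move=> ins; apply: (@sd_iter_barycentric _ (fun x => x i = 0)).
  exact: barycentric_eq0.
move=> y /mapP[j js ->]; rewrite /vertex; case: eqP => // ij.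
by rewrite ij js in ins.
Qed.

(** Induction on the face [s]: the parity of fully labelled cells is a sum of coboundaries, which
    the chain map property moves to the boundary. *)
Lemma sperner N (lab : V -> nat) k s : uniq s -> {subset s <= iota 0 N} ->
  (forall x, simplex N x -> 0 < x (lab x)) ->
  \sum_(t <- sd_iter k (map vertex s)) (perm_eq (map lab t) s)%:R = 1 :> 'F_2.
Proof.
move=> us sN labS; elim: s us sN => [|a s IH] us sN.
  have -> : sd_iter k (map vertex [::]) = [:: [::]] by elim: (k) => //= ? ->.
  by rewrite big_seq1.
(* Sperner's boundary condition: a point of a face has zero coordinates off it, so its label is a
   vertex of that face. *)
have lab_mem u t x : {subset u <= iota 0 N} ->
    t \in sd_iter k (map vertex u) -> x \in t -> lab x \in u.
  move=> uN tu xt; apply: contraT => labu.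
  by have := labS x (sd_iter_simplex uN tu xt); rewrite (sd_iter_support labu tu xt) ltxx.
under eq_big_seq => t ts.
  rewrite -coboundary_perm_eq//; last 2 first.
  - by rewrite size_map (size_sd_iter ts) size_map.
  - by move=> _ /mapP[x xt ->]; exact: lab_mem ts xt.
  rewrite /coboundary faces_map big_map.
  rewrite -/(coboundary (fun u => (perm_eq (map lab u) s)%:R) t).
over.
rewrite sum_sd_iter_coboundary// coboundary_cons IH; last 2 first.
- by have /andP[] := us.
- by move=> i si; apply: sN; rewrite inE si orbT.
(* Only the face opposite [a] contributes: any other face [a :: u] misses some [b] in [s], so the
   label [b] does not occur on it. *)
rewrite /coboundary faces_map big_map big_seq big1 ?addr0// => u us'.
have [|b bs bu] := face_missing _ us'; first by have /andP[] := us.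
rewrite big_seq big1// => t; rewrite -(map_cons vertex a u) => tu.
case: (boolP (perm_eq _ _)) => // /perm_mem/(_ b); rewrite bs => /mapP[x xt bx].
have : b \in a :: u.
  rewrite bx; apply: lab_mem tu xt => i iu; apply: sN; move: iu.
  by rewrite !inE => /predU1P[->|/(face_sub us') ->]; rewrite ?eqxx ?orbT.
rewrite inE (negbTE bu) orbF => /eqP ba.
by move: us; rewrite /= -ba bs.
Qed.

(** * Coface maps and the facets of the standard simplex *)

Definition insert0 j x : V := fun i => if i == j then 0 else x (unbump j i).

Lemma barycenter_insert0 j (s : seq V) :
  insert0 j (barycenter s) = barycenter (map (insert0 j) s).
Proof.
apply/funext => i; rewrite /insert0 /barycenter size_map big_map.
by case: eqP => // _; rewrite big1 ?mul0r.
Qed.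

Lemma insert0_vertex j i : insert0 j (vertex i) = vertex (bump j i).
Proof.
apply/funext => l; rewrite /insert0 /vertex.
case: eqP => [->|/eqP lj]; first by rewrite (negbTE (neq_bump _ _)).
congr (nat_of_bool _)%:R; apply/eqP/eqP => [<-|->]; last exact: bumpK.
by rewrite unbumpK.
Qed.

Lemma faces_iota m n t : t \in faces (iota m n.+1) ->
  exists2 j, (m <= j <= m + n)%N & t = map (bump j) (iota m n).
Proof.
elim: n m t => [|n IH] m t.
  by rewrite inE => /eqP ->; exists m; rewrite ?leqnn ?leq_addr.
rewrite -[iota m n.+2]/(m :: iota m.+1 n.+1) inE.
case/predU1P => [->|/mapP[u /IH[j jmn ->] ->]].
  exists m; first by rewrite leqnn leq_addr.
  rewrite (iotaDl 1 m); apply/eq_in_map => i; rewrite mem_iota /bump.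
  by case/andP => ->.
exists j; first by lia.
by rewrite /= {2}/bump; case: ltngtP jmn => //; lia.
Qed.

(** The coordinates of [x] serve as successive gaps of a finite set starting at 0. *)
Definition partial_sums n x : seq R := [seq \sum_(j < i) x j | i <- iota 0 n.+1].

Lemma sum_insert0 j x i :
  \sum_(l < i) insert0 j x l = \sum_(l < unbump j i) x l.
Proof.
elim: i => [|i IH]; first by rewrite /unbump sub0n !big_ord0.
rewrite big_ord_recr /= IH /insert0.
case: (ltngtP i j) => ij; last first.
- have -> : unbump j i.+1 = unbump j i by rewrite /unbump; lia.
  by rewrite addr0.
- have -> : unbump j i.+1 = (unbump j i).+1 by rewrite /unbump; lia.
  by rewrite big_ord_recr.
- have -> : unbump j i.+1 = (unbump j i).+1 by rewrite /unbump; lia.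
  by rewrite big_ord_recr.
Qed.

Lemma partial_sums_insert0 d j x : (j <= d)%N ->
  partial_sums d.+1 (insert0 j x) =i partial_sums d x.
Proof.
move=> jd y; apply/mapP/mapP => -[i]; rewrite mem_iota add0n => /andP[_ id] ->.
  exists (unbump j i); first by rewrite mem_iota add0n /unbump; lia.
  exact: sum_insert0.
exists (bump j i); first by rewrite mem_iota add0n /bump; lia.
by rewrite sum_insert0 bumpK.
Qed.

Lemma simplex_insert0 d j x : (j <= d)%N -> simplex d x -> simplex d.+1 (insert0 j x).
Proof.
move=> jd [x0 xd x1]; split.
- by move=> i; rewrite /insert0; case: eqP.
- move=> i di; rewrite /insert0; case: eqP => // ij; apply: xd.
  by rewrite /unbump; lia.
- rewrite sum_insert0 -x1.
  by have -> : unbump j d.+1 = d by rewrite /unbump; lia.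
Qed.

(* The facets of the standard simplex are [d.+1] copies of the same simplex. *)
Lemma sum_sd_iter_standard k d (phi psi : seq V -> 'F_2) :
  (forall j t, (j <= d)%N -> t \in sd_iter k (map vertex (iota 0 d)) ->
    phi (map (insert0 j) t) = psi t) ->
  \sum_(t <- sd_iter k (map vertex (iota 0 d.+1))) coboundary phi t =
  \sum_(t <- sd_iter k (map vertex (iota 0 d))) psi t *+ d.+1.
Proof.
move=> phipsi; rewrite sum_sd_iter_coboundary// /coboundary faces_map big_map.
rewrite (eq_big_seq (fun=>
  \sum_(t <- sd_iter k (map vertex (iota 0 d))) psi t)) => [|f fs].
  by rewrite big_const_seq count_predT iter_addr_0 size_faces size_iota sumrMnl.
have [j /andP[_ jd] ->] := faces_iota fs.
have -> : map vertex (map (bump j) (iota 0 d)) =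
    map (insert0 j) (map vertex (iota 0 d)).
  by rewrite -!map_comp; apply: eq_map => i /=; rewrite insert0_vertex.
rewrite (sd_iter_map _ _ (barycenter_insert0 j)) big_map.
by apply: eq_big_seq => t ts; exact: phipsi.
Qed.

End sperner.

(** * Labelling finite sets of reals *)

Section argmax.
Context {R : realType}.
Implicit Types x y : nat -> R.

Definition argmax d x :=
  find (fun i => all (fun j => x j <= x i) (iota 0 d)) (iota 0 d).

Lemma eq_argmax d x y : (forall i, (i < d)%N -> x i = y i) ->
  argmax d x = argmax d y.
Proof.
move=> xy; apply: eq_in_find => i; rewrite mem_iota => /andP[_ /xy ->].
by apply: eq_in_all => j; rewrite mem_iota => /andP[_ /xy ->].
Qed.

Lemma argmaxP d x : (0 < d)%N ->
  (argmax d x < d)%N /\ forall j, (j < d)%N -> x j <= x (argmax d x).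
Proof.
case: d => // d _; set p := fun i => all (fun j => x j <= x i) (iota 0 d.+1).
have hp : has p (iota 0 d.+1).
  case: (@Order.TotalTheory.arg_maxP _ _ 'I_d.+1 ord0 xpredT (fun i => x i)) => //.
  move=> i _ xi; apply/hasP; exists (val i); first by rewrite mem_iota ltn_ord.
  apply/allP => j; rewrite mem_iota => /andP[_ jd].
  exact: (xi (Ordinal jd)).
have ad : (argmax d.+1 x < d.+1)%N.
  by rewrite -[X in (_ < X)%N](size_iota 0) -has_find.
split=> // j jd.
have := nth_find 0%N hp; rewrite -/(argmax d.+1 x) nth_iota// add0n => /allP; apply.
by rewrite mem_iota.
Qed.

End argmax.

Section label.
Context {R : realType}.
Implicit Types (A B : seq R) (e h k : R).

Definition sorted_elems B := sort <=%R (undup B).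

Definition gap (b : seq R) i : R := b`_i.+1 - b`_i.

Definition separated d e B := (size (undup B) == d.+1) &&
  all (fun i => e < gap (sorted_elems B) i) (iota 0 d).

Definition label d e B :=
  if separated d e B then argmax d (gap (sorted_elems B)) else d.

Lemma size_sorted_elems B : size (sorted_elems B) = size (undup B).
Proof. exact: size_sort. Qed.

Lemma mem_sorted_elems B : sorted_elems B =i B.
Proof. by move=> x; rewrite mem_sort mem_undup. Qed.

Lemma sorted_elems_lt B : sorted <%R (sorted_elems B).
Proof. by rewrite sort_lt_sorted undup_uniq. Qed.

Lemma sorted_elems_eq A B : sorted <%R A -> A =i B -> sorted_elems B = A.
Proof.
move=> sA AB; apply: lt_sorted_eq => //; first exact: sorted_elems_lt.
by move=> x; rewrite mem_sorted_elems AB.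
Qed.

Lemma label_eq_mem d e A B : A =i B -> label d e A = label d e B.
Proof.
move=> AB; have E : sorted_elems A = sorted_elems B.
  apply: sorted_elems_eq; first exact: sorted_elems_lt.
  by move=> x; rewrite mem_sorted_elems AB.
by rewrite /label /separated -!size_sorted_elems E.
Qed.

Lemma label_le d e B : (0 < d)%N -> (label d e B <= d)%N.
Proof.
move=> d0; rewrite /label; case: ifP => // _.
by have [/ltnW] := argmaxP (gap (sorted_elems B)) d0.
Qed.

Lemma separatedP d e B :
  reflect (size (undup B) = d.+1 /\
           forall i, (i < d)%N -> e < gap (sorted_elems B) i)
          (separated d e B).
Proof.
apply: (iffP andP) => -[/eqP ? H]; split=> //.
  by move=> i id; apply: (allP H); rewrite mem_iota.
by apply/allP => i; rewrite mem_iota => /andP[_ /H].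
Qed.

Lemma label_lt d e B i : (label d e B == i) -> (i < d)%N -> (0 < d)%N ->
  separated d e B /\ forall j, (j < d)%N ->
    gap (sorted_elems B) j <= gap (sorted_elems B) i.
Proof.
rewrite /label; case: ifP => [sB /eqP <- id d0|_ /eqP->]; last by rewrite ltnn.
by split=> // j jd; have [_] := argmaxP (gap (sorted_elems B)) d0; apply.
Qed.

Definition near_sub h A B := forall x, x \in A -> exists2 y, y \in B & `|x - y| <= h.

(** Points of [B] chosen within [h] of the elements of [A] stay in strict order, since gaps exceed
    [2 * h]. They are [d.+1] in number, hence exhaust [B], and the order matches the two sets. *)
Lemma sorted_elems_stable d e h A B : 2 * h <= e -> separated d e A ->
  (size (undup B) <= d.+1)%N -> near_sub h A B ->
  size (undup B) = d.+1 /\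
  forall i, (i <= d)%N -> `|(sorted_elems A)`_i - (sorted_elems B)`_i| <= h.
Proof.
move=> he /separatedP[sA gA] sB AB; set a := sorted_elems A.
have sa : size a = d.+1 by rewrite size_sorted_elems.
have /choice[f fP] : forall i, exists y, (i <= d)%N -> y \in B /\ `|a`_i - y| <= h.
  (* Indices beyond [d] carry no condition and get the dummy value 0. *)
  move=> i; have [id|/negP id] := boolP (i <= d)%N; last by exists 0.
  have [|y yB ay] := AB a`_i; last by exists y.
  by rewrite -mem_sorted_elems mem_nth// sa.
set c := map f (iota 0 d.+1).
have sc : size c = d.+1 by rewrite size_map size_iota.
have nc i : (i <= d)%N -> c`_i = f i.
  by move=> id; rewrite (nth_map 0%N) ?size_iota// nth_iota.
have ltc : sorted <%R c.
  apply/(sortedP 0) => i; rewrite sc ltnS => id.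
  rewrite !nc//; last exact: ltnW.
  have [_] := fP _ (ltnW id); have [_] := fP _ id.
  have := gA _ id; rewrite /gap -/a !ler_norml => ? /andP[? ?] /andP[? ?]; lra.
have cB : {subset c <= undup B}.
  move=> _ /mapP[i id ->]; rewrite mem_undup.
  by move: id; rewrite mem_iota => /andP[_] /fP[].
have uc := lt_sorted_uniq ltc.
have [E cBE] := uniq_min_size uc cB (leq_trans sB (eq_leq (esym sc))).
split; first by rewrite -E.
move=> i id; rewrite (sorted_elems_eq ltc); last by move=> x; rewrite cBE mem_undup.
by rewrite nc//; have [] := fP _ id.
Qed.

Lemma diam_le_gaps d k B x y : size (undup B) = d.+1 -> x \in B -> y \in B ->
  0 <= k -> (forall i, (i < d)%N -> gap (sorted_elems B) i <= k) -> y - x <= d%:R * k.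
Proof.
move=> sB; rewrite -(mem_sorted_elems B x) -(mem_sorted_elems B y).
move=> /(nthP 0)[i id <-] /(nthP 0)[j jd <-] k0 gk.
move: id jd; rewrite size_sorted_elems sB => id jd.
set b := sorted_elems B.
have [ji|ij] := leqP j i.
  rewrite (@le_trans _ _ 0)// ?mulr_ge0// subr_le0.
  apply: sorted_leq_nth => //; rewrite ?inE ?size_sorted_elems ?sB//.
  - by move=> ? ? ?; exact: le_trans.
  - exact: sort_le_sorted.
rewrite -(telescope_sumr _ (ltnW ij)).
apply: (@le_trans _ _ (\sum_(i <= l < j) k)).
  rewrite big_nat [leRHS]big_nat; apply: ler_sum => l /andP[il lj].
  by apply: gk; lia.
by rewrite sumr_const_nat -[leLHS]mulr_natl ler_wpM2r// ler_nat; lia.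
Qed.

(** The label [d] next to a separated set forces a short gap [j], and the label [j] makes this short
    gap the longest one of a nearby set, whose diameter is then below [k]. *)
Lemma not_full d e h k (Bs : seq (seq R)) : (0 < d)%N -> 0 <= h -> 2 * h < e ->
  d%:R * (e + 4 * h) < k ->
  (forall B, B \in Bs -> (size (undup B) <= d.+1)%N) ->
  (forall A B, A \in Bs -> B \in Bs -> near_sub h A B) ->
  (forall B, B \in Bs -> exists x y, [/\ x \in B, y \in B & k <= y - x]) ->
  ~~ perm_eq (map (label d e) Bs) (d :: iota 0 d).
Proof.
move=> d0 h0 he dk sBs nBs kBs; apply/negP => full.
have lab i : (i <= d)%N -> exists2 B, B \in Bs & label d e B == i.
  move=> id; have : i \in map (label d e) Bs.
    by rewrite (perm_mem full) inE mem_iota; lia.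
  by case/mapP => B BBs ->; exists B.
have [B BBs B0] := lab 0%N (leq0n d).
have [C CBs Cd] := lab d (leqnn d).
have [sepB _] := label_lt B0 d0 d0.
(* If all gaps of [B] exceeded [e + 2 * h], those of [C] would exceed [e], and [C] would not have
   label [d]. *)
have [j jd Bj] : exists2 j, (j < d)%N & gap (sorted_elems B) j <= e + 2 * h.
  apply/not_exists2P => gB.
  have [sC BC] := sorted_elems_stable (ltW he) sepB (sBs _ CBs) (nBs _ _ BBs CBs).
  have sepC : separated d e C.
    apply/separatedP; split=> // i id.
    have [//|/negP] := gB i; rewrite -ltNge /gap => gi.
    have := BC _ id; have := BC _ (ltnW id).
    by rewrite /gap !ler_norml => /andP[? ?] /andP[? ?]; lra.
  move: Cd; rewrite /label sepC => /eqP Cd.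
  by have [] := argmaxP (gap (sorted_elems C)) d0; rewrite Cd ltnn.
(* Gap [j] of [D] is at most [e + 4 * h] by stability, and its label makes it the largest gap of
   [D]. *)
have [D DBs Dj] := lab j (ltnW jd).
have [/separatedP[sD _] gD] := label_lt Dj jd d0.
have [_ BD] := sorted_elems_stable (ltW he) sepB (sBs _ DBs) (nBs _ _ BBs DBs).
have [x [y [xD yD kxy]]] := kBs _ DBs.
have := diam_le_gaps (k := e + 4 * h) sD xD yD.
have k0 : 0 <= e + 4 * h by lra.
move=> /(_ k0); rewrite leNgt (lt_le_trans dk kxy) => H.
suff // : false by [].
apply: H => i id; apply: le_trans (gD _ id) _.
have := BD _ jd; have := BD _ (ltnW jd); move: Bj.
by rewrite /gap !ler_norml => ? /andP[? ?] /andP[? ?]; lra.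
Qed.

Lemma nth_partial_sums d (x : nat -> R) i : (i <= d)%N ->
  (partial_sums d x)`_i = \sum_(j < i) x j.
Proof. by move=> id; rewrite (nth_map 0%N) ?size_iota// nth_iota. Qed.

Lemma gap_partial_sums d (x : nat -> R) i : (i < d)%N ->
  gap (partial_sums d x) i = x i.
Proof.
move=> id; rewrite /gap !nth_partial_sums//; last exact: ltnW.
by rewrite big_ord_recr /= addrAC subrr add0r.
Qed.

Lemma label_partial_sums d e (x : nat -> R) : 0 <= e ->
  (forall i, 0 <= x i) -> label d e (partial_sums d x) =
    if all (fun i => e < x i) (iota 0 d) then argmax d x else d.
Proof.
move=> e0 x0; set P := partial_sums d x.
have sP : size P = d.+1 by rewrite size_map size_iota.
have ltP : sorted <%R P -> sorted_elems P = P.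
  by move=> sortP; exact: sorted_elems_eq.
have [ex|nex] := boolP (all _ _).
  have sortP : sorted <%R P.
    apply/(sortedP 0) => i; rewrite sP ltnS => id; rewrite -subr_gt0 -/(gap P i).
    rewrite gap_partial_sums//; apply: le_lt_trans e0 _.
    by apply: (allP ex); rewrite mem_iota.
  rewrite /label ifT; last first.
    apply/separatedP; rewrite -size_sorted_elems ltP//; split=> // i id.
    by rewrite gap_partial_sums//; apply: (allP ex); rewrite mem_iota.
  by apply: eq_argmax => i id; rewrite ltP// gap_partial_sums.
rewrite /label ifF//; apply: contraNF nex => /separatedP[uP gP].
(* Having [d.+1] distinct values, the nondecreasing list [P] has no repetition and is already its
   own sorted list. *)
have uniqP : uniq P by rewrite -[uniq P]negbK -ltn_size_undup uP sP ltnn.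
have sortP : sorted <%R P.
  rewrite lt_sorted_uniq_le uniqP andTb; apply/(sortedP 0) => i; rewrite sP ltnS => id.
  by rewrite -subr_ge0 -/(gap P i) gap_partial_sums.
apply/allP => i; rewrite mem_iota => /andP[_ id].
by have := gP _ id; rewrite ltP// gap_partial_sums.
Qed.

End label.

(** * Extending the identity of the facets to the simplex *)

Section no_retraction.
Context {R : realType}.

Lemma spread_vertex (s : seq nat) : spread (1 : R) (map vertex s).
Proof.
move=> x y i /mapP[j _ ->] /mapP[l _ ->]; rewrite /vertex.
by do 2 case: (_ == _); rewrite ?subrr ?subr0 ?sub0r ?normrN ?normr0 ?normr1.
Qed.

Lemma argmax_simplex d (x : nat -> R) : simplex d x -> 1 <= d%:R * x (argmax d x).
Proof.
case: d => [|d] [_ _ x1]; first by rewrite -x1 big_ord0 mul0r.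
have [_ xM] := argmaxP x (ltn0Sn d).
rewrite -[leLHS]x1; apply: (@le_trans _ _ (\sum_(i < d.+1) x (argmax d.+1 x))).
  by apply: ler_sum => i _; exact: xM.
by rewrite sumr_const card_ord -[leLHS]mulr_natl.
Qed.

Lemma argmax_simplex_gt0 d (x : nat -> R) : simplex d x -> 0 < x (argmax d x).
Proof.
move=> /argmax_simplex; case: (ltP 0 (x _)) => // x0.
by rewrite leNgt (le_lt_trans _ ltr01)// mulr_ge0_le0.
Qed.

Theorem no_retraction d (k : R) (rho : (nat -> R) -> seq R) :
  (0 < d)%N -> ~~ odd d -> 0 < k ->
  (forall x, simplex d.+1 x -> (size (undup (rho x)) <= d.+1)%N) ->
  (forall h, 0 < h -> exists2 e, 0 < e & forall x y,
     simplex d.+1 x -> simplex d.+1 y -> (forall i, `|x i - y i| <= e) ->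
     near_sub h (rho x) (rho y)) ->
  (forall x j, simplex d.+1 x -> (j <= d)%N -> x j = 0 ->
     rho x =i partial_sums d.+1 x) ->
  (forall x, simplex d.+1 x ->
     exists a b, [/\ a \in rho x, b \in rho x & k <= b - a]) ->
  False.
Proof.
move=> d0 even_d k0 rho_size rho_cont rho_bd rho_diam.
have dR : 0 < d%:R :> R by rewrite ltr0n.
(* Small against [k], so that [not_full] applies with threshold [4 * u] and error [u], and against
   1, so that a longest gap, at least [1 / d], exceeds [5 * u]. *)
pose u : R := Num.min k 1 / (16 * d%:R).
have kk : 0 < Num.min k 1 by rewrite lt_min k0 ltr01.
have u0 : 0 < u by rewrite divr_gt0// mulr_gt0.
have du : d%:R * u = Num.min k 1 / 16.
  by rewrite /u; field; rewrite gt_eqF.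
have duk : 8 * (d%:R * u) < k.
  have : Num.min k 1 <= k by rewrite ge_min lexx.
  rewrite du; move: kk; lra.
have du1 : 16 * (d%:R * u) <= 1.
  have : Num.min k 1 <= 1 by rewrite ge_min lexx orbT.
  rewrite du; lra.
have [e1 e10 rho_e1] := rho_cont u u0.
pose e := Num.min e1 u.
have e0 : 0 < e by rewrite lt_min e10.
have eu : e <= u by rewrite ge_min lexx orbT.
have ee1 : e <= e1 by rewrite ge_min lexx.
have [n sd_small] := @sd_iter_small R d 1 e ler01 e0.
have small s t : (size s <= d.+1)%N -> t \in sd_iter n (map vertex s) -> spread e t.
  by move=> sd; apply: sd_small; [rewrite size_map | exact: spread_vertex].
pose lab x := label d (4 * u) (rho x).
(* The two sides are compared modulo 2: on the left no cell carries all labels, on the right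
   [sperner] gives 1 on each of [d.+1] equal facets. *)
have := @sum_sd_iter_standard R n d (fun t => (perm_eq (map lab t) (iota 0 d))%:R)
  (fun t => (perm_eq (map (argmax d) t) (iota 0 d))%:R).
rewrite big_seq big1 => [|t tS]; last first.
  have tsimplex x : x \in t -> simplex d.+1 x by exact: sd_iter_simplex tS.
  have : coboundary (fun v => (perm_eq v (iota 0 d))%:R) (map lab t) = 0.
    rewrite (@coboundary_perm_eq _ d); last 3 first.
    - by rewrite /= iota_uniq mem_iota add0n ltnn.
    - by rewrite size_map (size_sd_iter tS) size_map !size_iota.
    - move=> _ /mapP[x _ ->]; have := label_le (4 * u) (rho x) d0.
      by rewrite inE mem_iota -/(lab x) leq_eqVlt => /orP[->|->]; rewrite ?orbT.
    rewrite (map_comp (label d (4 * u)) rho).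
    rewrite (negbTE (@not_full _ d (4 * u) u k _ d0 _ _ _ _ _ _))//.
    - exact: ltW.
    - lra.
    - move: duk; lra.
    - by move=> _ /mapP[x xt ->]; exact/rho_size/tsimplex.
    - move=> _ _ /mapP[x xt ->] /mapP[y yt ->]; apply: rho_e1; try exact: tsimplex.
      by move=> i; apply: le_trans ee1; apply: small tS _ _ _ xt yt; rewrite size_iota.
    - by move=> _ /mapP[x xt ->]; exact/rho_diam/tsimplex.
  by rewrite /coboundary faces_map big_map.
rewrite sumrMnl (@sperner _ d); last 3 first.
- exact: iota_uniq.
- by [].
- exact: argmax_simplex_gt0.
(* As [d.+1] is odd, the right side is 1. It remains to check the agreement on facets that [H] asks
   for. *)
rewrite natF2 /= even_d => H.
suff // : 0 = 1 :> 'F_2 by [].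
apply: H => j t jd tS.
have tsimplex x : x \in t -> simplex d x by exact: sd_iter_simplex tS.
have labE x : x \in t -> lab (insert0 j x) =
    if all (fun i => 4 * u < x i) (iota 0 d) then argmax d x else d.
  move=> /tsimplex xS; have [x0 _ _] := xS.
  rewrite -label_partial_sums//; last lra.
  apply: label_eq_mem => y; rewrite (rho_bd _ j)//; last first.
  - by rewrite /insert0 eqxx.
  - exact: simplex_insert0.
  exact: partial_sums_insert0.
(* If all gaps on the cell are long, both labellings agree. Otherwise both indicators vanish. *)
have [/allP good|/allPn[x xt /allPn[i id]]] :=
    boolP (all (fun x => all (fun i => 4 * u < x i) (iota 0 d)) t).
  congr (nat_of_bool (perm_eq _ _))%:R; rewrite -map_comp.
  by apply/eq_in_map => x xt /=; rewrite labE// good.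
rewrite -leNgt => xi.
rewrite (_ : perm_eq _ _ = false); last first.
  apply/negP => /perm_mem/(_ d); rewrite mem_iota ltnn => /negP; apply.
  apply/mapP; exists (insert0 j x); first exact: map_f.
  rewrite labE// ifF//; apply/negP => /allP/(_ i id).
  by rewrite ltNge xi.
(* Gap [i] is short at [x], so at most [5 * u] at every vertex of the cell; hence it is never the
   longest, and [argmax] omits [i]. *)
rewrite (_ : perm_eq _ _ = false)//; apply/negP => /perm_mem/(_ i).
rewrite id => /mapP[y yt iy].
have := argmax_simplex (tsimplex _ yt); rewrite -iy.
have : `|y i - x i| <= e by apply: small tS _ _ _ yt xt; rewrite size_iota.
rewrite ler_norml => /andP[_ yx] dy.
have yu : y i <= 5 * u by move: yx xi eu; lra.
have : d%:R * y i <= d%:R * (5 * u) by rewrite ler_wpM2l// ltW.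
have dup : 0 < d%:R * u by rewrite mulr_gt0.
move: dy du1 dup; lra.
Qed.

End no_retraction.

(** * Retractions of finite subsets of an interval *)

Lemma size_undup_lt (T : eqType) (z : T) (s : seq T) i j :
  (i < j)%N -> (j < size s)%N -> nth z s i = nth z s j ->
  (size (undup s) < size s)%N.
Proof.
move=> ij js sij; rewrite ltn_size_undup; apply/negP => us.
have := nth_uniq z (ltn_trans ij js) js us.
by rewrite sij eqxx (ltn_eqF ij).
Qed.

Section interval.
Context {R : realType}.
Implicit Types (S T U : seq R) (h k : R) (x : nat -> R).

Lemma near_sub_le h k S T : h <= k -> near_sub h S T -> near_sub k S T.
Proof. by move=> hk ST y /ST[z zT yz]; exists z => //; exact: le_trans hk. Qed.

Lemma near_sub_trans h k S T U :
  near_sub h S T -> near_sub k T U -> near_sub (h + k) S U.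
Proof.
move=> ST TU y /ST[z /TU[v vU zv] yz]; exists v => //.
by rewrite (le_trans (ler_distD z _ _))// lerD.
Qed.

Lemma near_sub_map (I : eqType) (s : seq I) (u v : I -> R) h :
  (forall i, i \in s -> `|u i - v i| <= h) -> near_sub h (map u s) (map v s).
Proof. by move=> uv _ /mapP[i si ->]; exists (v i); [exact: map_f | exact: uv]. Qed.

Lemma near_sub_cat h S T U : 0 <= h -> near_sub h S T -> near_sub h (S ++ U) (T ++ U).
Proof.
move=> h0 ST y; rewrite mem_cat => /orP[/ST[z zT yz]|yU].
  by exists z; rewrite // mem_cat zT.
by exists y; rewrite ?mem_cat ?yU ?orbT// subrr normr0.
Qed.

Lemma partial_sums_bounds d x y : simplex d x -> y \in partial_sums d x -> 0 <= y <= 1.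
Proof.
move=> [x0 _ x1] /mapP[i]; rewrite mem_iota => /andP[_ id] ->.
rewrite sumr_ge0//= -x1 -!(big_mkord xpredT x) [leRHS](@big_cat_nat _ _ _ i)//=.
by rewrite lerDl sumr_ge0.
Qed.

Lemma partial_sums0 d x : 0 \in partial_sums d x.
Proof. by apply/mapP; exists 0%N; rewrite ?mem_iota// big_ord0. Qed.

Lemma partial_sums1 d x : simplex d x -> 1 \in partial_sums d x.
Proof.
by move=> [_ _ <-]; apply/mapP; exists d => //; rewrite mem_iota add0n ltnSn.
Qed.

Lemma partial_sums_near d x y h : 0 <= h -> (forall i, `|x i - y i| <= h) ->
  near_sub (d%:R * h) (partial_sums d x) (partial_sums d y).
Proof.
move=> h0 xy; apply: near_sub_map => i; rewrite mem_iota => /andP[_ id].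
rewrite -sumrB; apply: le_trans (ler_norm_sum _ _ _) _.
apply: (@le_trans _ _ (\sum_(j < i) h)); first by apply: ler_sum => j _.
by rewrite sumr_const card_ord -[leLHS]mulr_natl ler_wpM2r// ler_nat.
Qed.

Lemma size_partial_sums d x : size (partial_sums d x) = d.+1.
Proof. by rewrite size_map size_iota. Qed.

Lemma simplex_min d x : simplex d.+1 x ->
  exists2 j, (j <= d)%N & d.+1%:R * x j <= 1.
Proof.
move=> [_ _ x1]; have [jd jmin] := argmaxP (fun i => - x i) (ltn0Sn d).
exists (argmax d.+1 (fun i => - x i)) => //; rewrite -[leRHS]x1.
set j := argmax _ _ in jd jmin *.
apply: (@le_trans _ _ (\sum_(i < d.+1) x j)).
  by rewrite sumr_const card_ord -[leRHS]mulr_natl.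
by apply: ler_sum => i _; rewrite -lerN2; exact: jmin.
Qed.

(* [T] replaces the points number [j] and [j.+1] by their midpoint. *)
Lemma merge_consecutive d x j U : (forall i, 0 <= x i) -> (j <= d)%N ->
  exists T, [/\ size T = d.+2, (size (undup (T ++ U)) < size (T ++ U))%N,
    (forall y, y \in T -> exists a b, [/\ a \in partial_sums d.+1 x,
        b \in partial_sums d.+1 x & y = (a + b) / 2]),
    near_sub (x j / 2) (partial_sums d.+1 x) T &
    near_sub (x j / 2) T (partial_sums d.+1 x)].
Proof.
move=> x0 jd; set P := fun i => \sum_(l < i) x l.
set m := fun i => if (i == j) || (i == j.+1) then (P j + P j.+1) / 2 else P i.
have Pj : P j.+1 = P j + x j by rewrite /P big_ord_recr.
have xj := x0 j.
have mP i : `|m i - P i| <= x j / 2.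
  rewrite /m; case: eqP => [->|_] /=; last case: eqP => [->|_].
  - by rewrite ler_norml Pj; apply/andP; split; lra.
  - by rewrite ler_norml Pj; apply/andP; split; lra.
  - by rewrite subrr normr0; lra.
have PP i : (i <= d.+1)%N -> P i \in partial_sums d.+1 x.
  by move=> id; apply: map_f; rewrite mem_iota.
exists (map m (iota 0 d.+2)); split.
- by rewrite size_map size_iota.
- apply: (@size_undup_lt _ 0 _ j j.+1) => //.
    by rewrite size_cat size_map size_iota; lia.
  rewrite !nth_cat size_map size_iota !ifT; try lia.
  rewrite !(nth_map 0%N) ?size_iota; try lia.
  by rewrite !nth_iota; try lia; rewrite /m !add0n !eqxx orbT.
- move=> y /mapP[i]; rewrite mem_iota => /andP[_ id] ->.
  rewrite /m; case: ifP => _; first by exists (P j), (P j.+1); split=> //; apply: PP; lia.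
  by exists (P i), (P i); split; [exact: PP|exact: PP|lra].
- by apply: near_sub_map => i _; rewrite distrC; exact: mP.
- by apply: near_sub_map => i _; exact: mP.
Qed.

End interval.

(** * Lower bound for retractions on finite subsets of [0, 2] *)

Section interval_retraction.
Context {R : realType}.
Implicit Types (S T : seq R).

(** Finite sets are represented by lists, repetitions allowed. The interval [0, 2] holds
    configurations in [0, 1] and the distant point 2. *)
Definition admissible n S :=
  [/\ S != [::], (size S <= n)%N & forall y, y \in S -> 0 <= y <= 2].

Context (n : nat) (L : R) (r : seq R -> seq R).
Context (n_ge4 : (4 <= n)%N) (L_ge0 : 0 <= L).
Context (r_size : forall S, admissible n S -> (size (r S) <= n.-1)%N).
Context (r_id : forall S, admissible n S ->
  (size (undup S) <= n.-1)%N -> r S =i S).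
Context (r_lip : forall S T (h : R), admissible n S -> admissible n T -> 0 <= h ->
  near_sub h S T -> near_sub h T S -> near_sub (L * h) (r S) (r T)).

(* [d.+2] is the even one of [n] and [n.-1]; if [n] is odd, the remaining point
   is kept at [2], at distance at least 1 from the others. *)
Let d := (n - 2 - odd n)%N.
Let far : seq R := nseq (odd n) 2.
Let conf (x : nat -> R) := partial_sums d.+1 x ++ far.
Let D := (L + 1) / (2 * d.+1%:R).

Let nE : n = (d.+2 + odd n)%N. Proof. by rewrite /d; lia. Qed.

Let size_conf x : size (conf x) = n.
Proof. by rewrite size_cat size_partial_sums size_nseq -nE. Qed.

Let d_gt0 : (0 < d)%N. Proof. by rewrite /d; lia. Qed.

Let d_even : ~~ odd d. Proof. by rewrite /d; lia. Qed.

Let mem_far y : y \in far -> y = 2.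
Proof. by rewrite mem_nseq => /andP[_ /eqP]. Qed.

Let conf_admissible x : simplex d.+1 x -> admissible n (conf x).
Proof.
move=> xS; split; first by rewrite -size_eq0 size_conf; lia.
  by rewrite size_conf.
move=> y; rewrite mem_cat => /orP[/(partial_sums_bounds xS)|/mem_far ->]; lra.
Qed.

(** The smallest of [d.+1] gaps of sum 1 is at most [1 / d.+1], which turns the displacement
    [(L + 1) * x j / 2] into the uniform bound [D]. *)
Let conf_displacement x : simplex d.+1 x ->
  near_sub D (r (conf x)) (conf x) /\ near_sub D (conf x) (r (conf x)).
Proof.
move=> xS; have [j jd xj] := simplex_min xS; have [x0 _ _] := xS.
have [T [sT uT Tmid xT Tx]] := merge_consecutive far x0 jd.
have xj0 : 0 <= x j / 2 by rewrite divr_ge0.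
have aT : admissible n (T ++ far).
  split; first by rewrite -size_eq0 size_cat sT.
    by rewrite size_cat sT size_nseq -nE.
  move=> y; rewrite mem_cat => /orP[/Tmid[a [b [aP bP ->]]]|/mem_far ->]; last lra.
  have := partial_sums_bounds xS aP; have := partial_sums_bounds xS bP; lra.
have rT : r (T ++ far) =i T ++ far.
  apply: r_id => //; move: uT; rewrite size_cat sT size_nseq -nE.
  by case: (n) n_ge4.
have xTF := near_sub_cat (U := far) xj0 xT; have TxF := near_sub_cat (U := far) xj0 Tx.
have ax := conf_admissible xS.
have LD : L * (x j / 2) + x j / 2 <= D.
  rewrite /D ler_pdivlMr ?mulr_gt0//.
  have -> : (L * (x j / 2) + x j / 2) * (2 * d.+1%:R) = (L + 1) * (d.+1%:R * x j).
    by field.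
  by rewrite ler_piMr// addr_ge0.
split; apply: near_sub_le LD _.
  apply: near_sub_trans (r_lip ax aT xj0 xTF TxF) _.
  by move=> y; rewrite rT; exact: TxF.
rewrite addrC; apply: (near_sub_trans xTF).
move=> y; rewrite -rT; exact: (r_lip aT ax xj0 TxF xTF).
Qed.

Lemma interval_retraction : n%:R - 3 <= L.
Proof.
rewrite leNgt; apply/negP => Ln.
(* Positive because [L < n - 3] and [n - 3 <= d], whatever the parity of [n]. *)
pose c : R := 1 / 2 - D.
have c0 : 0 < c.
  rewrite subr_gt0 /D ltr_pdivrMr ?mulr_gt0//.
  have -> : 1 / 2 * (2 * d.+1%:R) = d.+1%:R :> R by field.
  have : n%:R <= d.+1%:R + 2 :> R by rewrite -natrD ler_nat /d; lia.
  move: Ln; lra.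
have D0 : 0 <= D by rewrite /D divr_ge0 ?mulr_ge0// addr_ge0.
have DE : D = 1 / 2 - c by rewrite /c; lra.
(* The cut at [3 / 2] discards the points near 2. No point of [r (conf x)] lies within [c] of the
   cut, so cutting keeps continuity. *)
pose rho x := [seq y <- r (conf x) | y < 3 / 2].
have rho_le x y : simplex d.+1 x -> y \in rho x -> y <= 3 / 2 - c.
  move=> xS; rewrite mem_filter => /andP[y32 yr].
  have [z + yz] := (conf_displacement xS).1 _ yr.
  rewrite mem_cat => /orP[/(partial_sums_bounds xS)|/mem_far z2]; move: yz.
    by rewrite DE ler_norml; lra.
  by rewrite z2 DE ler_norml; lra.
apply: (@no_retraction R d (2 * c) rho) => //.
- by rewrite mulr_gt0.
- move=> x xS; apply: leq_trans (size_undup _) _.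
  have sr := r_size (conf_admissible xS).
  rewrite size_filter; case: (boolP (odd n)) => [n_odd|n_even]; last first.
    apply: leq_trans (count_size _ _) _; apply: leq_trans sr _.
    by rewrite {1}nE (negbTE n_even) addn0.
  (* For odd [n], [r (conf x)] may have [d.+2] entries, but one of them is near 2 and is
     discarded. *)
  have : 2 \in conf x by rewrite mem_cat /far n_odd mem_nseq eqxx orbT.
  case/(conf_displacement xS).2 => z zr z2.
  have cz : (0 < count (predC (fun y : R => y < 3 / 2)%R) (r (conf x)))%N.
    rewrite -has_count; apply/hasP; exists z => //=; rewrite -leNgt.
    by move: z2; rewrite DE ler_norml; lra.
  rewrite -ltnS; apply: leq_trans (_ : size (r (conf x)) <= d.+2)%N; last first.
    by apply: leq_trans sr _; rewrite {1}nE n_odd addn1.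
  by rewrite -(count_predC (fun y : R => y < 3 / 2) (r _)) -addn1 leq_add2l.
(* Moving by at most [c / 2] cannot cross the cut; [e] is chosen so that the images under [r] move
   by at most [m]. *)
- move=> h h0; pose m := Num.min h (c / 2).
  have m0 : 0 < m by rewrite lt_min h0 divr_gt0.
  have mh : m <= h by rewrite ge_min lexx.
  have mc : m <= c / 2 by rewrite ge_min lexx orbT.
  pose e := m / ((L + 1) * d.+1%:R).
  have L1 : 0 < L + 1 by rewrite ltr_wpDl.
  have e0 : 0 < e by rewrite divr_gt0// mulr_gt0.
  exists e => // x y xS yS xy z.
  have near u v : (forall i, `|u i - v i| <= e) ->
      near_sub (d.+1%:R * e) (conf u) (conf v).
    move=> uv; apply: near_sub_cat; first by rewrite mulr_ge0// ltW.
    by apply: partial_sums_near => //; exact: ltW.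
  have yx i : `|y i - x i| <= e by rewrite distrC.
  have de0 : 0 <= d.+1%:R * e by rewrite mulr_ge0// ltW.
  have Lm : L * (d.+1%:R * e) <= m.
    have -> : L * (d.+1%:R * e) = L / (L + 1) * m.
      by rewrite /e; field; rewrite gt_eqF//= nat1r pnatr_eq0.
    by rewrite ler_piMl ?(ltW m0)// ler_pdivrMr// mul1r lerDl.
  move=> zr; have := rho_le _ _ xS zr; move: zr.
  rewrite mem_filter => /andP[z32 zr] zc.
  have [v vr zv] := r_lip (conf_admissible xS) (conf_admissible yS) de0
    (near _ _ xy) (near _ _ yx) zr.
  have zvm := le_trans zv Lm.
  exists v; last exact: le_trans mh.
  rewrite mem_filter vr andbT; move: zvm; rewrite ler_norml; move: zc mc c0; lra.
- move=> x j xS jd xj0 y.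
  (* The zero gap repeats a point, so the configuration has at most [n.-1] elements and is fixed. *)
  have rE : r (conf x) =i conf x.
    apply: r_id; first exact: conf_admissible.
    suff : (size (undup (conf x)) < size (conf x))%N.
      by rewrite size_conf; case: (n) n_ge4.
    apply: (@size_undup_lt _ 0 _ j j.+1) => //; first by rewrite size_conf nE; lia.
    rewrite !nth_cat size_partial_sums !ifT; try lia.
    by rewrite !nth_partial_sums; try lia; rewrite big_ord_recr /= xj0 addr0.
  rewrite mem_filter rE mem_cat; apply/andP/idP => [[y32 /orP[//|/mem_far y2]]|yP].
    by move: y32; rewrite y2; lra.
  by rewrite yP; split=> //; have := partial_sums_bounds xS yP; lra.
(* The images near 0 and 1 differ by at least [1 - 2 * D = 2 * c]. *)
- move=> x xS; have near := (conf_displacement xS).2.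
  have [|a ar a0] := near 0; first by rewrite mem_cat partial_sums0.
  have [|b br b1] := near 1; first by rewrite mem_cat partial_sums1.
  exists a, b; move: a0 b1; rewrite DE !ler_norml => a0 b1.
  rewrite !mem_filter ar br !andbT; split; lra.
Qed.

End interval_retraction.

(** * Reduction to an interval *)

Lemma seq_fset_card_le (T : choiceType) (s : seq T) m :
  (size (undup s) <= m)%N -> s != [::] -> (0 < #|` seq_fset tt s | <= m)%N.
Proof.
move=> sm s0; rewrite size_seq_fset sm andbT.
case: s s0 {sm} => // x s _; rewrite -has_predT; apply/hasP.
by exists x; rewrite // mem_undup mem_head.
Qed.

Lemma size_undup_map (T U : eqType) (h : T -> U) (s : seq T) :
  (size (undup (map h s)) <= size (undup s))%N.
Proof.
rewrite -(size_map h); apply: uniq_leq_size; first exact: undup_uniq.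
move=> y; rewrite mem_undup => /mapP[x xs ->]; apply: map_f.
by rewrite mem_undup.
Qed.

Unset Implicit Arguments.

Theorem corollary5p2 (R : realType) (X : metricType R) (n : nat)
    (n_ge2 : (2 <= n)%N)
    (r : finsub X n -> finsub X n.-1)
    (r_retraction : lipschitz_retraction (leq_pred n) r)
    (I : set R^o) (I_interval : is_interval I) (I_compact : compact I)
    (I_nondegenerate : exists x y : R, I x /\ I y /\ x != y)
    (f : X -> I) (g : I -> X)
    (f_lipschitz : lipschitz_map f) (g_lipschitz : lipschitz_map g)
    (fg_id : cancel g f) :
  Lip r >= (n%:R - 3) / (Lip f * Lip g).
Proof.
have [a [b [Ia Ib ab]]] : exists a b : R, [/\ I a, I b & a < b].
  move: I_nondegenerate => [x [y [Ix [Iy]]]].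
  by rewrite neq_lt => /orP[xy|yx]; [exists x, y | exists y, x].
have [r_lip r_id] := r_retraction.
have r_Lip := Lip_lipschitz r_lip.
have f_Lip := Lip_lipschitz f_lipschitz.
have g_Lip := Lip_lipschitz g_lipschitz.
have f0 := Lip_ge0 f; have g0 := Lip_ge0 g; have r0 := Lip_ge0 r.
have distI (u v : I) : mdist u v = `|(set_val u : R) - set_val v|.
  by rewrite distrC.
(* The affine map [p] carries [0, 2] onto [a, b]; off [0, 2] its value may be the default [ia]. *)
pose w := (b - a) / 2.
have w0 : 0 < w by rewrite divr_gt0// subr_gt0.
pose ia : I := SigSub (mem_set Ia).
pose p (s : R) : I := insubd ia (a + w * s).
have pE s : 0 <= s <= 2 -> (set_val (p s) : R) = a + w * s.
  move=> s02; rewrite set_valE /p insubdK//; apply/mem_set.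
  apply: (I_interval a b) => //; rewrite /w; nra.
pose q (x : X) : R := ((set_val (f x) : R) - a) / w.
have qgp s : 0 <= s <= 2 -> q (g (p s)) = s.
  move=> s02; rewrite /q fg_id pE//; field; rewrite gt_eqF//.
(* The composite fixes two distinct points, so the product is at least 1 and the denominator is
   positive. *)
have fg1 : 1 <= Lip f * Lip g.
  pose ib : I := SigSub (mem_set Ib).
  have ab0 : 0 < `|a - b| by rewrite normr_gt0 subr_eq0 lt_eqF.
  have := le_trans (f_Lip (g ia) (g ib)) (ler_wpM2l f0 (g_Lip ia ib)).
  by rewrite !fg_id distI !set_valE mulrA ler_pMl.
rewrite ler_pdivrMr ?(lt_le_trans ltr01)//.
have [n3|n4] := leqP n 3.
  rewrite (@le_trans _ _ 0) ?mulr_ge0// subr_le0.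
  by rewrite -[leRHS]/(3%:R) ler_nat.
pose A0 : finsub X n := FinSub (seq_fset_card_le (s := [:: g ia]) (ltnW n_ge2) isT).
(* The default [A0] makes [conf] total; on admissible lists it is the image set, by [confE]. *)
pose conf (S : seq R) : finsub X n := insubd A0 (seq_fset tt (map (g \o p) S)).
pose rt (S : seq R) : seq R := map q (enum_fset (r (conf S))).
have confE S : admissible n S -> fset_of_finsub (conf S) = seq_fset tt (map (g \o p) S).
  move=> [S0 Sn _]; rewrite /conf; apply: insubdK.
  apply: seq_fset_card_le; last by rewrite -size_eq0 size_map size_eq0.
  by apply: leq_trans Sn; rewrite (leq_trans (size_undup _))// size_map.
apply: (@interval_retraction R n (Lip r * (Lip f * Lip g)) rt) => //.
- by rewrite !mulr_ge0.
- move=> S _; rewrite size_map; have /andP[_ ->//] := finsub_card (r (conf S)).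
- move=> S aS uS; have [S0 Sn S02] := aS.
  have TP : (0 < #|` seq_fset tt (map (g \o p) S) | <= n.-1)%N.
    apply: seq_fset_card_le; last by rewrite -size_eq0 size_map size_eq0.
    exact: leq_trans (size_undup_map _ _) uS.
  have cE : conf S = finsub_incl (leq_pred n) (FinSub TP).
    by apply: val_inj; rewrite /= confE.
  have memG x : x \in seq_fset tt (map (g \o p) S) = (x \in map (g \o p) S).
    exact: seq_fsetE.
  move=> y; rewrite /rt cE r_id; apply/mapP/idP => /= [[x]|yS].
    by rewrite memG => /mapP[s sS -> ->]; rewrite /= qgp ?S02.
  by exists (g (p y)); [rewrite memG; apply/mapP; exists y | rewrite qgp ?S02].
- move=> S T h aS aT h0 ST TS.
  have gp s t : 0 <= s <= 2 -> 0 <= t <= 2 -> `|s - t| <= h ->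
      mdist (g (p s)) (g (p t)) <= Lip g * (w * h).
    move=> s02 t02 st; apply: le_trans (g_Lip _ _) _.
    rewrite ler_wpM2l// distI !pE// opprD addrACA subrr add0r -mulrBr.
    by rewrite normrM (gtr0_norm w0) ler_wpM2l// ltW.
  have [_ _ S02] := aS; have [_ _ T02] := aT.
  have confST : mdist (conf S) (conf T) <= Lip g * (w * h).
    rewrite mdist_finsubE; apply/hausdorff_dist_leP; try exact: finsub_neq0.
    rewrite !confE//; split=> x; rewrite seq_fsetE => /mapP[s sS ->].
      have [t tT st] := ST s sS; exists (g (p t)); last first.
        exact: gp (S02 _ sS) (T02 _ tT) st.
      by rewrite seq_fsetE; apply/mapP; exists t.
    have [t tT] := TS s sS; rewrite distrC => st.
    exists (g (p t)); last exact: gp (S02 _ tT) (T02 _ sS) st.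
    by rewrite seq_fsetE; apply/mapP; exists t.
  have rST := le_trans (r_Lip (conf S) (conf T)) (ler_wpM2l r0 confST).
  move=> _ /mapP[x xS ->].
  have [z zT] := hausdorff_distl (finsub_neq0 _) (finsub_neq0 (r (conf T))) xS.
  rewrite -mdist_finsubE => /le_trans/(_ rST) xz.
  exists (q z); first exact: map_f.
  rewrite /q -mulrBl opprB addrA subrK normrM (gtr0_norm (_ : 0 < w^-1)) ?invr_gt0//.
  rewrite ler_pdivrMr// -distI; apply: le_trans (f_Lip _ _) _.
  apply: le_trans (ler_wpM2l f0 xz) _.
  (* The scale [w] of [p] cancels against the division by [w] in [q], leaving the product of the
     three constants. *)
  rewrite le_eqVlt; apply/orP; left; apply/eqP; ring.
Qed.
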